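(* For any subset $I\subseteq S$, let $N_I(tr)=\sum_{s\in I}M(tr)_{\{s\}}$, a $\mathfrak K G$-submodule of $M(tr)$. Then, as $\mathfrak K G$-modules, $M_I(tr)\cong M(tr)/N_I(tr)$.
   Context: $G$ is a connected reductive group over the algebraic closure $\bar{\mathbb F}_q$ of a finite field $\mathbb F_q$, defined over $\mathbb F_q$; $G$ is identified with the abstract group of its $\bar{\mathbb F}_q$-points. $B$ is a Borel subgroup defined over $\mathbb F_q$, $T\subseteq B$ a maximal torus defined over $\mathbb F_q$, $U$ the unipotent radical of $B$, $N=N_G(T)$, $W=N/T$ the Weyl group, and $S$ the set of simple reflections of $W$ determined by $B$. $\mathfrak K$ is a field and $\mathfrak K H$ denotes the (abstract) group algebra of a group $H$. For $I\subseteq S$, $W_I$ is the subgroup of $W$ generated by $I$, $N_I$ is the subgroup of $N$ containing $T$ with $N_I/T=W_I$, and $P_I=BN_IB$ is the standard parabolic subgroup. Set $M_I(tr)=\mathfrak K G\otimes_{\mathfrak K P_I}\mathfrak K_{tr}$, where $\mathfrak K_{tr}$ is the trivial one-dimensional module, and $M(tr)=M_\emptyset(tr)=\mathfrak K G\otimes_{\mathfrak K B}\mathfrak K_{tr}$. Let $1_{tr}$ be a fixed nonzero element of $\mathfrak K_{tr}$ and write $x1_{tr}$ for $x\otimes 1_{tr}$. For $w\in W$ put $w1_{tr}=n_w1_{tr}$, where $n_w\in N$ is any representative of $w$ (this is independent of the choice). For $s\in S$, $M(tr)_{\{s\}}$ denotes the $\mathfrak K G$-submodule of $M(tr)$ generated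 by $1_{tr}-s1_{tr}$ (it equals $\mathfrak K UW(1-s)1_{tr}$). *)

(* Defs.v *)
From HB Require Import structures.
From mathcomp Require Import all_boot all_algebra.
From mathcomp Require Import ring_quotient.
From mathcomp Require Import finmap.
From mathcomp Require Import -(notations) mpoly.
From mathcomp Require Import monalg.
From mathcomp Require Import boolp classical_sets.

Set Implicit Arguments.
Unset Strict Implicit.
Unset Printing Implicit Defensive.

Import GRing.Theory.

Local Open Scope classical_set_scope.
Local Open Scope ring_scope.

(* mpoly and monalg have clashing notations; those of monalg are kept, except
   this one. *)
Notation "{ 'mpoly' R [ n ] }" := (mpoly.mpoly n R) : type_scope.

Section Subgroups.
Context (G : groupType).
Implicit Types (H N X Y : set G).

Definition subgroup H : Prop :=
  [/\ H 1%g, forall x y, H x -> H y -> H (x * y)%g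
    & forall x, H x -> H (x^-1)%g].

Definition gen_subgroup X : set G :=
  [set x | forall H, subgroup H -> X `<=` H -> H x].

Definition normal_in H N : Prop :=
  forall x y, H x -> N y -> N (y ^ x)%g.

Definition normalizer H : set G :=
  [set x | forall y, H (y ^ x)%g <-> H y].

Definition derived H : set G :=
  gen_subgroup [set z | exists x y, [/\ H x, H y & z = [~ x, y]%g]].

Definition solvable_group H : Prop :=
  exists m, iter m derived H `<=` [set 1%g].

Definition setM X Y : set G :=
  [set z | exists x y, [/\ X x, Y y & z = (x * y)%g]].

Definition setV X : set G := [set z | exists2 x, X x & z = (x^-1)%g].

Definition coset H (x : G) : set G := setM [set x] H.

End Subgroups.

(* A linear algebraic group over k is presented as an abstract group G together
   with an identification rho of G with a Zariski closed subgroup of GL_n(k). *)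
Section AlgebraicGroups.
Context (k : closedFieldType) (n : nat) (G : groupType) (rho : G -> 'M[k]_n).
Implicit Types (H T X : set G).

Definition mxeval (p : {mpoly k[n * n]}) (A : 'M[k]_n) : k :=
  meval (fun i => mxvec A 0 i) p.

Definition closed_embedding : Prop :=
  [/\ rho 1%g = 1%:M, {morph rho : x y / (x * y)%g >-> x *m y}, injective rho
    & exists P : set {mpoly k[n * n]}, forall A, A \in unitmx ->
        (range rho A <-> forall p, P p -> mxeval p A = 0)].

Definition zclosed X : Prop :=
  exists P : set {mpoly k[n * n]},
    X = [set x | forall p, P p -> mxeval p (rho x) = 0].

Definition zconnected X : Prop :=
  forall C D, zclosed C -> zclosed D -> X `<=` C `|` D ->
    X `&` (C `&` D) = set0 -> X `<=` C \/ X `<=` D.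

Definition identity_component H : set G :=
  [set x | exists C, [/\ C `<=` H, zconnected C, C 1%g & C x]].

Definition closed_subgroup H : Prop := subgroup H /\ zclosed H.

Definition vanishing_ideal X : set {mpoly k[n * n]} :=
  [set p | forall x, X x -> mxeval p (rho x) = 0].

(* The ideal of X is generated by polynomials with coefficients in F. *)
Definition defined_over (F : fieldType) (iota : {rmorphism F -> k}) X : Prop :=
  forall p, vanishing_ideal X p ->
    exists m (c : 'I_m -> {mpoly k[n * n]}) (f : 'I_m -> {mpoly F[n * n]}),
      (forall i, vanishing_ideal X (map_mpoly iota (f i)))
      /\ p = \sum_i c i * map_mpoly iota (f i).

Definition unipotent_group H : Prop :=
  forall x, H x -> exists m, (rho x - 1%:M) ^+ m = 0.

(* R_u(G) is the largest closed connected normal unipotent subgroup. *)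
Definition reductive : Prop :=
  forall H, closed_subgroup H -> zconnected H -> normal_in [set: G] H ->
    unipotent_group H -> H `<=` [set 1%g].

Definition borel (B : set G) : Prop :=
  [/\ closed_subgroup B, zconnected B, solvable_group B
    & forall B', closed_subgroup B' -> zconnected B' -> solvable_group B' ->
        B `<=` B' -> B' `<=` B].

Definition regular_on X (f : G -> k) : Prop :=
  exists (p : {mpoly k[n * n]}) (m : nat),
    forall x, X x -> f x * \det (rho x) ^+ m = mxeval p (rho x).

(* phi is an isomorphism of algebraic groups from H onto (k^* )^r, with inverse
   psi; the regular functions on (k^* )^r are the Laurent polynomials. *)
Definition torus H : Prop :=
  closed_subgroup H /\
  exists r (phi : G -> 'rV[k]_r) (psi : 'rV[k]_r -> G),
    [/\ forall x i, H x -> phi x 0 i != 0,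
        forall x y i, H x -> H y -> phi (x * y)%g 0 i = phi x 0 i * phi y 0 i,
        forall i, regular_on H (fun x => phi x 0 i),
        (forall x, H x -> psi (phi x) = x)
          /\ (forall c : 'rV[k]_r, (forall i, c 0 i != 0) ->
                H (psi c) /\ phi (psi c) = c)
      & forall i j, exists (p : {mpoly k[r]}) (m : nat),
          forall c : 'rV[k]_r, (forall l, c 0 l != 0) ->
            rho (psi c) i j * (\prod_l c 0 l) ^+ m = meval (fun l => c 0 l) p].

Definition maximal_torus (T : set G) : Prop :=
  torus T /\ forall T', torus T' -> T `<=` T' -> T' `<=` T.

(* Tangent space at 1, as a subspace of the tangent space 'M_n of GL_n. *)
Definition lie_algebra H : set 'M[k]_n :=
  [set A | forall p, vanishing_ideal H p ->
     \sum_i mxeval (mderiv i p) 1%:M * mxvec A 0 i = 0].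

(* Roots of H relative to T, i.e. the nontrivial weights of T on Lie(H).
   Only the values on T of alpha : G -> k are meaningful. *)
Definition is_root H T (alpha : G -> k) : Prop :=
  (exists A, [/\ lie_algebra H A, A != 0
     & forall t, T t -> rho t *m A *m rho t^-1%g = alpha t *: A])
  /\ exists2 t, T t & alpha t != 1.

(* The positive roots are those of B; the simple ones are the indecomposable
   ones (characters are written multiplicatively). *)
Definition simple_root B T (alpha : G -> k) : Prop :=
  is_root B T alpha
  /\ ~ exists beta gamma, [/\ is_root B T beta, is_root B T gamma
         & forall t, T t -> alpha t = beta t * gamma t].

(* W = N_G(T)/T, its elements being cosets of T. *)
Definition weyl_group T : set (set G) :=
  [set w | exists2 x, normalizer T x & w = coset T x].

(* s_alpha is the nontrivial element of W which has a representative
   centralizing the identity component of the kernel of alpha. *)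
Definition reflection T (alpha : G -> k) : set (set G) :=
  [set w | exists x, [/\ normalizer T x, ~ T x,
     forall z, identity_component [set t | T t /\ alpha t = 1] z -> commute x z
     & w = coset T x]].

Definition simple_reflections B T : set (set G) :=
  [set w | exists2 alpha, simple_root B T alpha & reflection T alpha w].

End AlgebraicGroups.

Section Parabolics.
Context (G : groupType) (B T : set G).
Implicit Types (I V : set (set G)).

Definition weyl_subgroup V : Prop :=
  [/\ V `<=` weyl_group T, V T, forall v w, V v -> V w -> V (setM v w)
    & forall w, V w -> V (setV w)].

Definition weyl_gen I : set (set G) :=
  [set w | forall V, weyl_subgroup V -> I `<=` V -> V w].

Definition weyl_preimage I : set G :=
  [set x | normalizer T x /\ weyl_gen I (coset T x)].

Definition parabolic I : set G := setM (setM B (weyl_preimage I)) B.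

End Parabolics.

(* {malg K[G]} is the module of finitely supported functions G -> K; it carries
   a ring structure in monalg only for monomials, which excludes groups. *)
Definition group_algebra (K : fieldType) (G : groupType) : Type := {malg K[G]}.

Section GroupAlgebra.
Context (K : fieldType) (G : groupType).
Local Notation KG := (group_algebra K G).

HB.instance Definition _ := GRing.Lmodule.copy KG {malg K[G]}.

Implicit Types (a b : KG).

Definition gelt (x : G) : KG := << 1 *g x >>.

Definition gmul a b : KG :=
  \sum_(x <- msupp a) \sum_(y <- msupp b) << a@_x * b@_y *g (x * y)%g >>.

Lemma gmulw (d1 d2 : {fset G}) a b :
  (msupp a `<=` d1)%fset -> (msupp b `<=` d2)%fset ->
  gmul a b = \sum_(x <- d1) \sum_(y <- d2) << a@_x * b@_y *g (x * y)%g >>.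
Proof.
move=> le_d1 le_d2; rewrite /gmul (big_fset_incl _ le_d1) /=.
  apply/eq_bigr=> x _; apply/big_fset_incl => // y _ /mcoeff_outdom ->.
  by rewrite mulr0 monalgU0.
move=> x _ /mcoeff_outdom ax.
by rewrite big1 => // y _; rewrite ax mul0r monalgU0.
Qed.

Lemma gmul0g : left_zero 0 gmul.
Proof. by move=> a; rewrite /gmul msupp0 big_seq_fset0. Qed.

Lemma gmulg0 : right_zero 0 gmul.
Proof. by move=> a; rewrite /gmul big1 // => x _; rewrite msupp0 big_seq_fset0. Qed.

Lemma gmulDl : left_distributive gmul +%R.
Proof.
move=> a b c.
rewrite (gmulw (msuppD_le a b) (fsubset_refl (msupp c))).
rewrite (gmulw (fsubsetUl (msupp a) (msupp b)) (fsubset_refl (msupp c))).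
rewrite (gmulw (fsubsetUr (msupp a) (msupp b)) (fsubset_refl (msupp c))).
rewrite -big_split /=; apply/eq_bigr=> x _.
rewrite -big_split /=; apply/eq_bigr=> y _.
by rewrite mcoeffD mulrDl monalgUD.
Qed.

Lemma gmulDr : right_distributive gmul +%R.
Proof.
move=> c a b.
rewrite (gmulw (fsubset_refl (msupp c)) (msuppD_le a b)).
rewrite (gmulw (fsubset_refl (msupp c)) (fsubsetUl (msupp a) (msupp b))).
rewrite (gmulw (fsubset_refl (msupp c)) (fsubsetUr (msupp a) (msupp b))).
rewrite -big_split /=; apply/eq_bigr=> x _.
rewrite -big_split /=; apply/eq_bigr=> y _.
by rewrite mcoeffD mulrDr monalgUD.
Qed.

Lemma gmulUU (c d : K) (x y : G) :
  gmul << c *g x >> << d *g y >> = << c * d *g (x * y)%g >>.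
Proof. by rewrite (gmulw msuppU_le msuppU_le) !big_seq_fset1 !mcoeffUU. Qed.

Lemma gmul_suml (J : Type) (r : seq J) (F : J -> KG) b :
  gmul (\sum_(j <- r) F j) b = \sum_(j <- r) gmul (F j) b.
Proof.
exact: (big_morph (gmul^~ b) (fun _ _ => gmulDl _ _ _) (gmul0g _)).
Qed.

Lemma gmul_sumr (J : Type) (r : seq J) (F : J -> KG) b :
  gmul b (\sum_(j <- r) F j) = \sum_(j <- r) gmul b (F j).
Proof.
exact: (big_morph (gmul b) (fun _ _ => gmulDr _ _ _) (gmulg0 _)).
Qed.

Lemma gmul1 : left_id (gelt 1%g) gmul.
Proof.
move=> a; rewrite {1}(monalgE a) gmul_sumr [RHS]monalgE.
by apply: eq_bigr => x _; rewrite gmulUU mul1r mul1g.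
Qed.

Lemma gmulr1 : right_id (gelt 1%g) gmul.
Proof.
move=> a; rewrite {1}(monalgE a) gmul_suml [RHS]monalgE.
by apply: eq_bigr => x _; rewrite gmulUU mulr1 mulg1.
Qed.

Lemma gmulA : associative gmul.
Proof.
have galgE (a : KG) : a = \sum_(x <- msupp a) (<< a@_x *g x >> : KG).
  exact: monalgE.
move: gmulUU gmul_suml gmul_sumr; move: gmul => m mUU m_suml m_sumr a b c.
rewrite (galgE a) (galgE b) (galgE c).
rewrite !m_suml; apply: eq_bigr => x _.
rewrite [LHS]m_sumr [in RHS](m_sumr _ (msupp b)) m_suml.
apply: eq_bigr => y _; rewrite !m_sumr; apply: eq_bigr => z _.
by rewrite !mUU mulrA mulgA.
Qed.

Lemma gelt1_neq0 : gelt 1%g != 0.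
Proof. by apply/eqP/malgP=> /(_ 1%g) /eqP; rewrite mcoeffUU mcoeff0 oner_eq0. Qed.

HB.instance Definition _ := GRing.Zmodule_isNzRing.Build KG
  gmulA gmul1 gmulr1 gmulDl gmulDr gelt1_neq0.

(* KP, as a subset of KG. *)
Definition supported_on (P : set G) : set KG :=
  [set a | forall x, x \in msupp a -> P x].

Definition augmentation a : K := \sum_(x <- msupp a) a@_x.

Lemma augmentationw (d : {fset G}) a :
  (msupp a `<=` d)%fset -> augmentation a = \sum_(x <- d) a@_x.
Proof. by move=> le_d; apply/big_fset_incl => // x _ /mcoeff_outdom. Qed.

Lemma augmentationD : {morph augmentation : a b / a + b}.
Proof.
move=> a b; rewrite (augmentationw (msuppD_le a b)).
rewrite (augmentationw (fsubsetUl (msupp a) (msupp b))).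
rewrite (augmentationw (fsubsetUr (msupp a) (msupp b))).
by rewrite -big_split; apply: eq_bigr => x _; rewrite mcoeffD.
Qed.

Lemma augmentationU (c : K) (x : G) : augmentation << c *g x >> = c.
Proof. by rewrite (augmentationw msuppU_le) big_seq_fset1 mcoeffUU. Qed.

Lemma augmentation0 : augmentation 0 = 0.
Proof. by rewrite /augmentation msupp0 big_seq_fset0. Qed.

Lemma augmentation1 : augmentation 1 = 1.
Proof. exact: augmentationU. Qed.

Lemma augmentationM : {morph augmentation : a b / a * b}.
Proof.
have aug_sum := big_morph _ augmentationD augmentation0.
move=> a b; rewrite [a * b]/(gmul a b) /gmul aug_sum mulr_suml.
apply: eq_bigr => x _; rewrite aug_sum mulr_sumr.
by apply: eq_bigr => y _; rewrite augmentationU.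
Qed.

End GroupAlgebra.

(* The trivial module; the second argument only serves to attach the KG-module
   structure. *)
Definition trivial_module (K : fieldType) (G : groupType) : Type := K.

Section TrivialModule.
Context (K : fieldType) (G : groupType).
Local Notation Ktr := (trivial_module K G).

HB.instance Definition _ := GRing.Zmodule.copy Ktr K.

Definition trivial_scale (a : group_algebra K G) (c : Ktr) : Ktr :=
  augmentation a * (c : K).

Lemma trivial_scaleA a b c :
  trivial_scale a (trivial_scale b c) = trivial_scale (a * b) c.
Proof. by rewrite /trivial_scale augmentationM mulrA. Qed.

Lemma trivial_scale1 : left_id 1 trivial_scale.
Proof. by move=> c; rewrite /trivial_scale augmentation1 mul1r. Qed.

Lemma trivial_scaleDr : right_distributive trivial_scale +%R.
Proof. by move=> a c d; rewrite /trivial_scale mulrDr. Qed.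

Lemma trivial_scaleDl c : {morph trivial_scale^~ c : a b / a + b}.
Proof. by move=> a b; rewrite /trivial_scale augmentationD mulrDl. Qed.

HB.instance Definition _ :=
  GRing.Zmodule_isLmodule.Build (group_algebra K G) Ktr
    trivial_scaleA trivial_scale1 trivial_scaleDr trivial_scaleDl.

End TrivialModule.

Record submodule (R : nzRingType) (V : lmodType R) := Submodule {
  submodule_pred :> {pred V};
  submodule_closed : submod_closed submodule_pred
}.

HB.instance Definition _ (R : nzRingType) (V : lmodType R) (M : submodule V) :=
  GRing.isSubmodClosed.Build R V (submodule_pred M) (submodule_closed M).

Section Submodules.
Context (R : nzRingType) (V : lmodType R).

Definition span_pred (X : set V) : {pred V} := fun v =>
  `[< exists m (c : 'I_m -> R) (x : 'I_m -> V),
        (forall i, X (x i)) /\ v = \sum_i c i *: x i >].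

Lemma span_closed X : submod_closed (span_pred X).
Proof.
split.
  apply/asboolP; exists 0%N, (fun=> 0), (fun=> 0).
  by split=> [[]|]; rewrite ?big_ord0.
move=> a u v /asboolP[m [c [x [Xx ->]]]] /asboolP[m' [c' [x' [Xx' ->]]]].
apply/asboolP; exists (m + m')%N.
exists (fun i => match split i with inl j => a * c j | inr j => c' j end).
exists (fun i => match split i with inl j => x j | inr j => x' j end).
split=> [i|]; first by case: (split i).
rewrite big_split_ord /= scaler_sumr; congr (_ + _); apply: eq_bigr => i _.
  by rewrite (unsplitK (inl _ i)) scalerA.
by rewrite (unsplitK (inr _ i)).
Qed.

Definition span (X : set V) : submodule V := Submodule (span_closed X).

Definition sum_pred (J : Type) (D : set J) (F : J -> submodule V) :
    {pred V} := fun v =>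
  `[< exists m (j : 'I_m -> J) (x : 'I_m -> V),
        (forall i, D (j i) /\ x i \in F (j i)) /\ v = \sum_i x i >].

Lemma sum_closed J D F : submod_closed (@sum_pred J D F).
Proof.
split.
  apply/asboolP; exists 0%N, (fun i : 'I_0 => False_rect _ (notF (ltn_ord i))).
  by exists (fun=> 0); split=> [[]|]; rewrite ?big_ord0.
move=> a u v /asboolP[m [j [x [Xx ->]]]] /asboolP[m' [j' [x' [Xx' ->]]]].
apply/asboolP; exists (m + m')%N.
exists (fun i => match split i with inl l => j l | inr l => j' l end).
exists (fun i => match split i with inl l => a *: x l | inr l => x' l end).
split=> [i|].
  case: (split i) => l //; have [Dl Fl] := Xx l.
  by split=> //; apply: rpredZ.
rewrite big_split_ord /= scaler_sumr; congr (_ + _); apply: eq_bigr => i _.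
  by rewrite (unsplitK (inl _ i)).
by rewrite (unsplitK (inr _ i)).
Qed.

Definition sum_submodule (J : Type) (D : set J) (F : J -> submodule V) :
  submodule V := Submodule (sum_closed D F).

End Submodules.

Definition quot_module (R : nzRingType) (V : lmodType R)
  (M : submodule V) : Type := Quotient.quot M.

Section QuotientModule.
Context (R : nzRingType) (V : lmodType R) (M : submodule V).
Local Notation Q := (quot_module M).
Local Open Scope quotient_scope.

HB.instance Definition _ := GRing.Zmodule.copy Q (Quotient.quot M).

Definition quot_proj (v : V) : Q := \pi_(Quotient.quot M) v.

Definition quot_scale (a : R) (q : Q) : Q :=
  quot_proj (a *: repr (q : Quotient.quot M)).

Lemma quot_projE u v : (quot_proj u == quot_proj v) = (u - v \in M).
Proof. by rewrite Quotient.idealrBE. Qed.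

Lemma quot_projD : {morph quot_proj : u v / u + v}.
Proof. by move=> u v; rewrite /quot_proj Quotient.pi_add. Qed.

Lemma quot_projK q : quot_proj (repr (q : Quotient.quot M)) = q.
Proof. exact: reprK. Qed.

Lemma quot_projZ a v : quot_scale a (quot_proj v) = quot_proj (a *: v).
Proof.
apply/eqP; rewrite /quot_scale quot_projE -scalerBr rpredZ //.
by rewrite -quot_projE quot_projK.
Qed.

Lemma quot_scaleA a b q : quot_scale a (quot_scale b q) = quot_scale (a * b) q.
Proof. by rewrite -[q]quot_projK !quot_projZ scalerA. Qed.

Lemma quot_scale1 : left_id 1 quot_scale.
Proof. by move=> q; rewrite -[q]quot_projK !quot_projZ scale1r. Qed.

Lemma quot_scaleDr : right_distributive quot_scale +%R.
Proof.
move=> a q r; rewrite -[q]quot_projK -[r]quot_projK -quot_projD !quot_projZ.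
by rewrite scalerDr quot_projD.
Qed.

Lemma quot_scaleDl q : {morph quot_scale^~ q : a b / a + b}.
Proof.
by move=> a b; rewrite -[q]quot_projK !quot_projZ scalerDl quot_projD.
Qed.

HB.instance Definition _ := GRing.Zmodule_isLmodule.Build R Q
  quot_scaleA quot_scale1 quot_scaleDr quot_scaleDl.

End QuotientModule.

(* R (x)_S N for a subring S of R (given as a set) and an S-module N whose
   action is restricted from R.  The pure tensor r (x) x is the class of
   << r *g x >>: in the free left R-module on N, additivity in r is built in,
   and the relations impose additivity in x and rs (x) x = r (x) sx. *)
Section Tensor.
Context (R : nzRingType) (S : set R) (N : lmodType R).

Definition tensor_relations : set {malg R[N]} :=
  [set z | exists x y : N, z = << x + y >> - << x >> - << y >>] `|`
  [set z | exists (s : R) (x : N), S s /\ z = << s *g x >> - << s *: x >>].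

Definition tensor : Type := quot_module (span tensor_relations).

HB.instance Definition _ := GRing.Lmodule.on tensor.

Definition pure_tensor (r : R) (x : N) : tensor :=
  quot_proj (span tensor_relations) << r *g x >>.

End Tensor.

Section PermutationModules.
Context (K : fieldType) (G : groupType).
Local Notation KG := (group_algebra K G).
Local Notation Ktr := (trivial_module K G).

(* KG (x)_{KP} K_tr *)
Definition induced_trivial (P : set G) : lmodType KG :=
  tensor (supported_on (K := K) P) Ktr.

Context (B T : set G) (e : Ktr).

Definition M_parabolic (I : set (set G)) : lmodType KG :=
  induced_trivial (parabolic B T I).

Definition M_tr : lmodType KG := induced_trivial B.

(* e plays the role of the chosen nonzero element 1_tr of K_tr. *)
Definition one_tr : M_tr := pure_tensor (supported_on B) 1 e.

(* The generators 1_tr - n 1_tr for the representatives n of s all coincide. *)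
Definition M_s (s : set G) : submodule M_tr :=
  span [set v | exists2 x, s x & v = one_tr - gelt K x *: one_tr].

Definition N_I (I : set (set G)) : submodule M_tr := sum_submodule I M_s.

End PermutationModules.

(* Main.v *)
Require Import Defs.
From HB Require Import structures.
From mathcomp Require Import all_boot all_algebra.
From mathcomp Require Import finmap.
From mathcomp Require Import monalg.
From mathcomp Require Import boolp classical_sets.

(** M_P = KG (x)_{KP} K_tr is the universal KG-module with a vector fixed by
    [P]: a KG-linear map out of M_P amounts to a vector fixed by [P], namely the
    image of the generator [1 (x) e].  Existence of the map is
    [induced_trivial_lift], its uniqueness is [induced_trivial_ext].

    Dividing M(tr) by N_I(tr) keeps a generator fixed by [B] and makes it fixed,
    in addition, by all elements of the cosets [s] in [I].  The elements of [G]
    fixing a given vector form a subgroup, and P_I lies in every subgroup that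
    contains [B] and these cosets ([parabolic_min]).  Hence the generator of
    M(tr)/N_I(tr) is fixed by P_I, and there is a linear map [f] from M_I(tr) to
    M(tr)/N_I(tr) which sends generator to generator.

    Conversely, [B] and the cosets [s] in [I] lie in P_I ([subset_parabolic],
    [generator_subset_parabolic]), so they fix the generator of M_I(tr).  Since
    [B] fixes it, there is a linear map from M(tr) to M_I(tr) preserving the
    generators; since the cosets [s] fix it, this map kills N_I(tr) and factors
    through a linear map [h] on the quotient.  Both composites of [f] and [h] preserve the generators, so they
    are the identity by uniqueness. *)

Set Implicit Arguments.
Unset Strict Implicit.
Unset Printing Implicit Defensive.

Import GRing.Theory.

Local Open Scope classical_set_scope.
Local Open Scope ring_scope.

(** * Linear maps on spans, sums and quotients *)

Section LinearMapsOnQuotients.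
Context (R : nzRingType) (V W : lmodType R).
Implicit Types (M : submodule V) (g : {linear V -> W}).

Lemma quot_proj_is_linear M : linear (quot_proj M).
Proof. by move=> a u v; rewrite quot_projD -quot_projZ. Qed.

HB.instance Definition _ M :=
  GRing.isLinear.Build R V (quot_module M) *:%R (quot_proj M)
    (quot_proj_is_linear M).

Lemma linear_span0 g (X : set V) :
  (forall x, X x -> g x = 0) -> forall v, v \in Defs.span X -> g v = 0.
Proof.
move=> gX v /asboolP[m [c [x [Xx ->]]]].
by rewrite linear_sum big1 // => i _; rewrite linearZ /= gX // scaler0.
Qed.

Lemma linear_sum_submodule0 g (J : Type) (D : set J) (F : J -> submodule V) :
  (forall j, D j -> forall x, x \in F j -> g x = 0) ->
  forall v, v \in sum_submodule D F -> g v = 0.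
Proof.
move=> gF v /asboolP[m [j [x [Fx ->]]]].
by rewrite linear_sum big1 // => i _; case: (Fx i) => Dj; apply: gF.
Qed.

Lemma quot_lift M g : (forall v, v \in M -> g v = 0) ->
  exists f : {linear quot_module M -> W}, forall v, f (quot_proj M v) = g v.
Proof.
move=> gM; pose f (q : quot_module M) := g (repr (q : Quotient.quot M)).
have fE v : f (quot_proj M v) = g v.
  apply/eqP; rewrite -subr_eq0 -linearB /= gM //.
  by rewrite -quot_projE quot_projK.
have f_lin : linear f.
  move=> a q r; rewrite -[q]quot_projK -[r]quot_projK -linearP /= !fE.
  exact: linearP.
pose fL := GRing.isLinear.Build R (quot_module M) W *:%R f f_lin.
by exists (HB.pack f fL : {linear quot_module M -> W}).
Qed.

End LinearMapsOnQuotients.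

Lemma mem_span (R : nzRingType) (V : lmodType R) (X : set V) x :
  X x -> x \in Defs.span X.
Proof.
move=> Xx; apply/asboolP; exists 1%N, (fun=> 1), (fun=> x).
by split=> //; rewrite big_ord1 scale1r.
Qed.

Lemma mem_sum_submodule (R : nzRingType) (V : lmodType R) (J : Type)
    (D : set J) (F : J -> submodule V) j x :
  D j -> x \in F j -> x \in sum_submodule D F.
Proof.
move=> Dj Fx; apply/asboolP; exists 1%N, (fun=> j), (fun=> x).
by split=> //; rewrite big_ord1.
Qed.

(** * Cosets of T in its normalizer *)

Section Cosets.
Context (G : groupType) (T : set G).
Hypothesis T_sub : subgroup T.
Implicit Types (x y : G).

Lemma mem_cosetP x y : coset T x y <-> exists2 t, T t & y = (x * t)%g.
Proof.
split=> [[_ [t [-> Tt ->]]]|[t Tt ->]]; first by exists t.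
by exists x, t.
Qed.

Lemma coset_refl x : coset T x x.
Proof.
by case: (T_sub) => T1 _ _; apply/mem_cosetP; exists 1%g; rewrite ?mulg1.
Qed.

Lemma coset1 : coset T 1%g = T.
Proof.
apply/seteqP; split=> z; first by move=> /mem_cosetP[t Tt ->]; rewrite mul1g.
by move=> Tz; apply/mem_cosetP; exists z; rewrite ?mul1g.
Qed.

Lemma coset_mulr x t : T t -> coset T (x * t)%g = coset T x.
Proof.
case: (T_sub) => _ TM TV Tt; apply/seteqP; split=> _ /mem_cosetP[u Tu ->];
  apply/mem_cosetP.
  by exists (t * u)%g; [apply: TM | rewrite mulgA].
by exists (t^-1 * u)%g; [apply: TM => //; apply: TV | rewrite mulgA mulgK].
Qed.

Lemma normalizer1 : normalizer T 1%g.
Proof. by move=> y; rewrite conjg1. Qed.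

Lemma normalizerM x y : normalizer T x -> normalizer T y ->
  normalizer T (x * y)%g.
Proof. by move=> Nx Ny z; rewrite conjgM; split=> [/Ny/Nx|/Nx/Ny]. Qed.

Lemma normalizerV x : normalizer T x -> normalizer T (x^-1)%g.
Proof. by move=> Nx z; have := Nx (z ^ x^-1)%g; rewrite conjgKV => -[]. Qed.

Lemma subset_normalizer : T `<=` normalizer T.
Proof.
case: (T_sub) => _ TM TV.
have TJ t z : T t -> T z -> T (z ^ t)%g.
  by move=> Tt Tz; apply: (TM); [apply: TV | apply: TM].
move=> t Tt z; split=> [Tzt|]; last exact: TJ.
by rewrite -(conjgK t z); apply: (TJ) => //; apply: TV.
Qed.

Lemma coset_setM x y : normalizer T y ->
  setM (coset T x) (coset T y) = coset T (x * y)%g.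
Proof.
case: (T_sub) => _ TM _ Ny; apply/seteqP; split=> z.
  case=> _ [_ [/mem_cosetP[t Tt ->] /mem_cosetP[u Tu ->] ->]].
  apply/mem_cosetP; exists (t ^ y * u)%g; first by apply: TM => //; apply/Ny.
  by rewrite mulgA -(mulgA x t) (conjgC t) !mulgA.
case/mem_cosetP=> t Tt ->; exists x, (y * t)%g.
by split; [exact: coset_refl | apply/mem_cosetP; exists t | rewrite mulgA].
Qed.

Lemma coset_setV x : normalizer T x -> setV (coset T x) = coset T (x^-1)%g.
Proof.
case: (T_sub) => _ _ TV Nx; apply/seteqP; split=> z.
  (* (x t)^-1 = t^-1 x^-1 = x^-1 (x t^-1 x^-1), and x normalizes T. *)
  case=> _ /mem_cosetP[t Tt ->] ->; apply/mem_cosetP.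
  exists (t^-1 ^ x^-1)%g; last by rewrite invgM [LHS]conjgC.
  by apply/(normalizerV Nx); apply: TV.
case/mem_cosetP=> t Tt ->; exists (x * t^-1 ^ x)%g.
  by apply/mem_cosetP; exists (t^-1 ^ x)%g => //; apply/Nx; apply: TV.
by rewrite -conjgC invgM invgK.
Qed.

End Cosets.

(** * Subgroups containing a standard parabolic subgroup *)

Section Parabolic.
Context (G : groupType) (B T : set G) (I : set (set G)).
Hypotheses (B_sub : subgroup B) (T_sub : subgroup T) (TB : T `<=` B).

Lemma weyl_gen1 : weyl_gen T I T.
Proof. by move=> V []. Qed.

Lemma mem_parabolic b x c : B b -> weyl_preimage T I x -> B c ->
  parabolic B T I (b * x * c)%g.
Proof. by move=> Bb Nx Bc; exists (b * x)%g, c; split=> //; exists b, x. Qed.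

Lemma weyl_preimage_subset_parabolic : weyl_preimage T I `<=` parabolic B T I.
Proof.
case: (B_sub) => B1 _ _ x Nx.
by rewrite -(mulg1 x) -(mul1g x); apply: mem_parabolic.
Qed.

Lemma subset_parabolic : B `<=` parabolic B T I.
Proof.
case: (B_sub) => B1 _ _ b Bb; rewrite -(mul1g b) -(mul1g 1%g).
apply: mem_parabolic => //; split; first exact: normalizer1.
by rewrite coset1; apply: weyl_gen1.
Qed.

Lemma generator_subset_parabolic s :
  I `<=` weyl_group T -> I s -> s `<=` parabolic B T I.
Proof.
move=> IW Is x sx; apply: weyl_preimage_subset_parabolic.
have [y Ny sE] := IW s Is; move: sx; rewrite sE => /mem_cosetP[t Tt ->].
split; first by apply: normalizerM => //; apply: subset_normalizer.
by rewrite coset_mulr // -sE => V _; apply.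
Qed.

(** The elements of [W] contained in [H] as cosets form a subgroup of [W], which
    contains the generators of [W_I].  So the preimage of [W_I] in the normalizer
    of [T] lies in [H], and P_I is its product with [B] on both sides. *)
Lemma parabolic_min (H : set G) : I `<=` weyl_group T -> subgroup H ->
  B `<=` H -> (forall s, I s -> s `<=` H) -> parabolic B T I `<=` H.
Proof.
move=> IW [_ HM HV] BH IH _ [_ [c [[b [x [Bb [_ Wx] ->]]] Bc ->]]].
apply: (HM); last exact: BH.
apply: (HM); first exact: BH.
have [_ ] : (weyl_group T `&` [set w | w `<=` H]) (coset T x).
  apply: Wx => [|s Is]; last by split; [apply: IW | apply: IH].
  split=> [w []//||v w|w].
  - split; last by move=> t /TB; apply: BH.
    by exists 1%g; [exact: normalizer1 | rewrite coset1].
  - move=> [[y Ny ->] yH] [[z Nz ->] zH]; split.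
      by exists (y * z)%g; [exact: normalizerM | rewrite coset_setM].
    by move=> _ [a [d [/yH Ha /zH Hd ->]]]; apply: HM.
  - move=> [[y Ny ->] yH]; split.
      by exists (y^-1)%g; [exact: normalizerV | rewrite coset_setV].
    by move=> _ [a /yH Ha ->]; apply: HV.
by apply; exact: coset_refl.
Qed.

End Parabolic.

(** * Fixed vectors in modules over the group algebra *)

Section FixedVectors.
Context (K : fieldType) (G : groupType).
Local Notation KG := (group_algebra K G).
Implicit Types (x y : G) (a : KG) (c d : K).

(** The embedding of the scalars of [K] in the group algebra; it lets [K] act on
    a module over the group algebra. *)
Definition gscalar c : KG := << c *g 1%g >>.

Lemma geltM x y : gelt K (x * y)%g = gelt K x * gelt K y.
Proof. by rewrite [RHS]gmulUU mulr1. Qed.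

Lemma gscalar1 : gscalar 1 = 1.
Proof. by []. Qed.

Lemma gscalarD c d : gscalar (c + d) = gscalar c + gscalar d.
Proof. exact: monalgUD. Qed.

Lemma gscalarM c d : gscalar (c * d) = gscalar c * gscalar d.
Proof. by rewrite [RHS]gmulUU mulg1. Qed.

Lemma mul_gscalar_gelt c x : gscalar c * gelt K x = << c *g x >>.
Proof. by rewrite [LHS]gmulUU mulr1 mul1g. Qed.

Lemma mul_gelt_gscalar c x : gelt K x * gscalar c = << c *g x >>.
Proof. by rewrite [LHS]gmulUU mul1r mulg1. Qed.

Lemma gscalar_trivial c (d : trivial_module K G) : gscalar c *: d = (c * d : K).
Proof. by rewrite [LHS]/(trivial_scale _ _) /trivial_scale augmentationU. Qed.

Lemma gelt_trivial x (d : trivial_module K G) : gelt K x *: d = d.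
Proof.
by rewrite [LHS]/(trivial_scale _ _) /trivial_scale augmentationU mul1r.
Qed.

Lemma supported_on_gelt (P : set G) x c : P x -> supported_on P << c *g x >>.
Proof.
by move=> Px y; move/(fsubsetP msuppU_le); rewrite in_fset1 => /eqP->.
Qed.

Context (V : lmodType KG).
Implicit Types (v : V).

Definition stabilizer v : set G := [set x | gelt K x *: v = v].

Lemma stabilizer_subgroup v : subgroup (stabilizer v).
Proof.
split=> [|x y xv yv|x xv]; rewrite /stabilizer /=.
- exact: scale1r.
- by rewrite geltM -scalerA yv xv.
- by rewrite -{1}xv scalerA -geltM mulVg; apply: scale1r.
Qed.

(** The image of [gscalar] is central, since [c x = x c] for [x] in [G]. *)
Lemma stabilizer_gscalar c v : stabilizer v `<=` stabilizer (gscalar c *: v).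
Proof.
move=> x xv; rewrite /stabilizer /= scalerA mul_gelt_gscalar.
by rewrite -mul_gscalar_gelt -scalerA xv.
Qed.

(** When [P] fixes [v], the line [Kv] is a quotient of the trivial module: KP
    acts on it through the augmentation. *)
Lemma supported_on_fix (P : set G) v a : P `<=` stabilizer v ->
  supported_on P a -> a *: v = gscalar (augmentation a) *: v.
Proof.
move=> Pv Pa.
have gscalar_sum := big_morph _ gscalarD (monalgU0 _ : gscalar 0 = 0).
rewrite /augmentation gscalar_sum {1}[a]monalgE !scaler_suml.
apply: eq_big_seq => x /Pa /Pv xv.
by rewrite -mul_gscalar_gelt -scalerA xv.
Qed.

End FixedVectors.

Section FixedVectorsLinear.
Context (K : fieldType) (G : groupType) (V : lmodType (group_algebra K G)).

Lemma stabilizer_linear (W : lmodType (group_algebra K G))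
  (f : {linear V -> W}) v : stabilizer v `<=` stabilizer (f v).
Proof. by move=> x xv; rewrite /stabilizer /= -linearZ /= xv. Qed.

Lemma stabilizer_quot_proj (M : submodule V) v x :
  v - gelt K x *: v \in M -> stabilizer (quot_proj M v) x.
Proof.
by move=> Mv; apply/esym/eqP; rewrite [_ *: _]quot_projZ quot_projE.
Qed.

End FixedVectorsLinear.

(** * Free modules and tensor products *)

Section FreeModule.
Context (R : nzRingType) (N : choiceType).
Implicit Types (r : R) (x : N).

Lemma scale_malgU r r' x : r *: << r' *g x >> = << r * r' *g x >> :> {malg R[N]}.
Proof.
by apply/malgP=> y; rewrite mcoeffZ !mcoeffU; case: eqP; rewrite ?mulr0.
Qed.

Lemma free_lift (W : lmodType R) (phi : N -> W) :
  exists g : {linear {malg R[N]} -> W}, forall r x, g << r *g x >> = r *: phi x.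
Proof.
pose g (a : {malg R[N]}) := \sum_(x <- msupp a) a@_x *: phi x.
have gw (d : {fset N}) a : (msupp a `<=` d)%fset ->
    g a = \sum_(x <- d) a@_x *: phi x.
  move=> le_d; apply/big_fset_incl => // x _ /mcoeff_outdom ->.
  by rewrite scale0r.
have g_lin : linear g.
  (* The supports of a, b and r a + b differ: sum over a common superset. *)
  move=> r a b; pose d := (msupp a `|` msupp b `|` msupp (r *: a + b))%fset.
  rewrite (@gw d a) ?(@gw d b) ?(@gw d (r *: a + b)) /d.
  - rewrite scaler_sumr -big_split; apply: eq_bigr => x _.
    by rewrite mcoeffD mcoeffZ scalerDl scalerA.
  - exact: fsubsetUr.
  - by rewrite (fsubset_trans (fsubsetUr (msupp a) _)) // fsubsetUl.
  - by rewrite (fsubset_trans (fsubsetUl _ (msupp b))) // fsubsetUl.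
pose gL := GRing.isLinear.Build R {malg R[N]} W *:%R g g_lin.
exists (HB.pack g gL : {linear {malg R[N]} -> W}) => r x /=.
by rewrite (gw _ _ msuppU_le) big_seq_fset1 mcoeffUU.
Qed.

End FreeModule.

Section Tensor.
Context (R : nzRingType) (S : set R) (N : lmodType R).
Implicit Types (r s : R) (x : N).

Lemma scale_pure_tensor r s x :
  r *: pure_tensor S s x = pure_tensor S (r * s) x.
Proof. by rewrite [LHS]quot_projZ scale_malgU. Qed.

Lemma pure_tensor_balanced s x :
  S s -> pure_tensor S s x = pure_tensor S 1 (s *: x).
Proof.
move=> Ss; apply/eqP; rewrite quot_projE.
by apply: mem_span; right; exists s, x.
Qed.

End Tensor.

(** * The universal property of the induced trivial module *)

Section InducedTrivial.
Context (K : fieldType) (G : groupType) (P : set G).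
Hypothesis P1 : P 1%g.
Context (e : trivial_module K G).
Hypothesis e_neq0 : e != 0.
Local Notation KG := (group_algebra K G).
Local Notation Ktr := (trivial_module K G).
Local Notation MP := (induced_trivial K P).
Local Notation eP := (pure_tensor (supported_on P) 1 e : MP).

(** For [x] in [P], [x] moves across the tensor sign and acts trivially on [e]. *)
Lemma subset_stabilizer_generator : P `<=` stabilizer eP.
Proof.
move=> x Px; rewrite /stabilizer /= scale_pure_tensor mulr1.
by rewrite pure_tensor_balanced ?gelt_trivial //; apply: supported_on_gelt.
Qed.

(** Since [c = (c / e) e] and the scalars belong to KP, every pure tensor is a
    multiple of the generator. *)
Lemma pure_tensor_gscalar (a : KG) (c : Ktr) :
  pure_tensor (supported_on P) a c =
  (a * gscalar G ((c : K) / (e : K))) *: eP :> MP.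
Proof.
have cE : gscalar G ((c : K) / (e : K)) *: e = c.
  by rewrite gscalar_trivial divfK.
rewrite -scalerA [in RHS]scale_pure_tensor mulr1.
rewrite [in RHS]pure_tensor_balanced ?cE; last exact: supported_on_gelt.
by rewrite scale_pure_tensor mulr1.
Qed.

(** The module is spanned by pure tensors, which are multiples of the
    generator. *)
Lemma induced_trivial_ext (W : lmodType KG) (f g : {linear MP -> W}) :
  f eP = g eP -> f =1 g.
Proof.
have projE (v : {malg KG[Ktr]}) : quot_proj _ v =
    \sum_(c <- msupp v) pure_tensor (supported_on P) v@_c c :> MP.
  by rewrite {1}[v]monalgE linear_sum.
move=> fg q; rewrite -[q]quot_projK projE !linear_sum; apply: eq_bigr => c _.
by rewrite pure_tensor_gscalar !linearZ /= fg.
Qed.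

(** On the free module on [K_tr], the map sends the basis element [c] to
    [(c / e) w].  It respects additivity in [c] by linearity, and the relations
    for [s] in KP because KP acts on [Kw] through the augmentation. *)
Lemma induced_trivial_lift (W : lmodType KG) (w : W) : P `<=` stabilizer w ->
  exists f : {linear MP -> W}, f eP = w.
Proof.
move=> Pw.
have [g gE] := free_lift (fun c : Ktr => gscalar G ((c : K) / (e : K)) *: w).
have [v|f fE] :=
  @quot_lift _ _ W (Defs.span (@tensor_relations _ (supported_on P) Ktr)) g.
  apply: linear_span0 => z [[c [d ->]]|[s [c [Ps ->]]]].
    rewrite !linearB /= !gE !scale1r mulrDl gscalarD scalerDl.
    by rewrite -addrA -opprD subrr.
  rewrite linearB /= !gE scale1r; apply/eqP; rewrite subr_eq0; apply/eqP.
  rewrite [LHS](supported_on_fix (P := P)) //.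
    by rewrite scalerA -gscalarM mulrA.
  by move=> x /Pw; apply: stabilizer_gscalar.
by exists f; rewrite [LHS]fE gE divff // gscalar1 !scale1r.
Qed.

End InducedTrivial.

(** * The isomorphism *)

Theorem theorem6p3
  (Fq : finFieldType) (k : closedFieldType) (iota : {rmorphism Fq -> k})
  (alg_k : forall x : k, algebraicOver iota x)
  (G : groupType) (n : nat) (rho : G -> 'M[k]_n)
  (G_alg : closed_embedding rho) (G_conn : zconnected rho [set: G])
  (G_red : reductive rho) (G_rat : defined_over rho iota [set: G])
  (B : set G) (B_borel : borel rho B) (B_rat : defined_over rho iota B)
  (T : set G) (TB : T `<=` B) (T_max : maximal_torus rho T)
  (T_rat : defined_over rho iota T)
  (K : fieldType) (e : trivial_module K G) (e_neq0 : e != 0)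
  (I : set (set G)) (IS : I `<=` simple_reflections rho B T) :
  exists f : {linear M_parabolic K B T I -> quot_module (N_I B e I)},
    bijective f.
Proof.
have [[B_sub _] _ _ _] := B_borel.
have [[[T_sub _] _] _] := T_max.
have IW : I `<=` weyl_group T.
  by move=> s /IS[alpha _ [x [Nx _ _ ->]]]; exists x.
have [[B1 _ _] BP] := (B_sub, @subset_parabolic _ B T I B_sub).
have P1 := BP _ B1.
pose P := parabolic B T I.
pose eP : M_parabolic K B T I := pure_tensor (supported_on P) 1 e.
pose pr : {linear M_tr K B -> quot_module (N_I B e I)} := quot_proj (N_I B e I).
pose eQ := pr (one_tr B e).
have B_eQ : B `<=` stabilizer eQ.
  move=> x /(subset_stabilizer_generator e); exact: stabilizer_linear.
have P_eQ : P `<=` stabilizer eQ.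
  refine (parabolic_min T_sub TB IW (stabilizer_subgroup eQ) B_eQ _).
  move=> s Is x sx; apply: stabilizer_quot_proj.
  by apply: (mem_sum_submodule Is); apply: mem_span; exists x.
have P_eP : P `<=` stabilizer eP := subset_stabilizer_generator e.
have [f fE] := induced_trivial_lift e_neq0 P_eQ.
have [g gE] := induced_trivial_lift e_neq0 (subset_trans BP P_eP).
have [h hE] : exists h : {linear quot_module (N_I B e I) -> M_parabolic K B T I},
    forall v, h (pr v) = g v.
  apply: quot_lift; apply: linear_sum_submodule0 => s Is.
  apply: linear_span0 => _ [x sx ->].
  rewrite linearB linearZ /= [g _]gE.
  by rewrite (P_eP x (generator_subset_parabolic B_sub T_sub IW Is sx)) subrr.
exists f, h.
  apply: (@induced_trivial_ext _ _ _ P1 _ e_neq0 _ (h \o f) idfun).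
  by rewrite /= [f _]fE hE [g _]gE.
move=> q; rewrite -[q]quot_projK.
apply: (@induced_trivial_ext _ _ _ B1 _ e_neq0 _ (f \o h \o pr) pr).
by rewrite /= hE [g _]gE [f _]fE.
Qed.
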